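(* Let $\mathcal{Q}$ be a small quantaloid, let $r\in\mathcal{Q}_0$, and let $(X,\alpha)$ and $(Y,\beta)$ be separated and cocomplete $\mathcal{Q}$-categories. Suppose that $\varphi\colon(Y,\beta)\to(X,\alpha)$ and $\chi\colon(X,\alpha)\to(\mathbb{R}(\mathcal{R}^{r}),\varrho)$ are cocontinuous functors such that the square $$\chi\circ\varphi=\mathrm{true}_r\circ|\cdot|,$$ with top arrow $\varphi\colon(Y,\beta)\to(X,\alpha)$, left vertical arrow $\chi\colon (X,\alpha)\to(\mathbb{R}(\mathcal{R}^{r}),\varrho)$, right vertical arrow the type map $|\cdot|\colon(Y,\beta)\to(\mathcal{Q},\tau)$ and bottom arrow $\mathrm{true}_r\colon(\mathcal{Q},\tau)\to(\mathbb{R}(\mathcal{R}^{r}),\varrho)$, is a pullback square in $\mathtt{Cat}_{sc}(\mathcal{Q})$. Then $$\chi(x)=\bigvee_{y\in Y_0}\alpha(x,\varphi(y))\circ\tau(|y|,r),\qquad x\in X_0.$$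
   Context: **Quantaloids.** A small quantaloid $\mathcal{Q}$ is a small category (object set $\mathcal{Q}_0$, set of all morphisms $\mathrm{morph}(\mathcal{Q})$, identities $1_p$) in which each $\hom(p,q)$ is a complete lattice and composition $\circ\colon\hom(q,r)\times\hom(p,q)\to\hom(p,r)$ preserves arbitrary joins in each variable. For $u\in\hom(p,q)$, $v\in\hom(p,r)$ (same domain): $u\swarrow v=\bigvee\{h\in\hom(r,q)\mid h\circ v\le u\}$. For $u\in\hom(p,q)$, $v\in\hom(r,q)$ (same codomain): $v\searrow u=\bigvee\{h\in\hom(p,r)\mid v\circ h\le u\}$. **$\mathcal{Q}$-categories and functors.** A typed set is a set $X_0$ with a map $|\cdot|\colon X_0\to\mathcal{Q}_0$ (type map). A $\mathcal{Q}$-category $(X,\alpha)$ is a typed set $X$ with $\alpha\colon X_0\times X_0\to\mathrm{morph}(\mathcal{Q})$ such that $\alpha(x,y)\in\hom(|y|,|x|)$, $\alpha(x,y)\circ\alpha(y,z)\le\alpha(x,z)$ and $1_{|x|}\le\alpha(x,x)$. A functor $\varphi\colon(X,\alpha)\to(Y,\beta)$ is a type-preserving map $X_0\to Y_0$ with $\alpha(x_1,x_2)\le\beta(\varphi(x_1),\varphi(x_2))$. $(X,\alpha)$ is separated if $|x|=|y|$, $\alpha(x,x)=\alpha(x,y)$ and $\alpha(y,y)=\alpha(y,x)$ imply $x=y$. **Presheaves, cocompleteness.** A contravariant $\mathcal{Q}$-presheaf on $(X,\alpha)$ is a pair $(p,g)$ with $p\in\mathcal{Q}_0$ (its type) and $g\colon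 X_0\to\mathrm{morph}(\mathcal{Q})$ such that $g(x)\in\hom(p,|x|)$ and $\alpha(x_1,x_2)\circ g(x_2)\le g(x_1)$. These form a $\mathcal{Q}$-category $(P(X,\alpha),\pi)$ with $\pi((p_1,g_1),(p_2,g_2))=\bigwedge_{x\in X_0}(g_1(x)\searrow g_2(x))$. The Yoneda embedding is $\eta_{(X,\alpha)}\colon(X,\alpha)\to(P(X,\alpha),\pi)$, $x\mapsto(|x|,\alpha(\underline{\phantom{x}},x))$. $(X,\alpha)$ is cocomplete if $\eta_{(X,\alpha)}$ has a left adjoint functor $\sup_X\colon(P(X,\alpha),\pi)\to(X,\alpha)$, i.e. $\alpha(\sup_X(p,g),x)=\pi((p,g),\eta_{(X,\alpha)}(x))$ for all $x,(p,g)$. For a functor $\varphi\colon(X,\alpha)\to(Y,\beta)$, the functor $\mathbb{P}(\varphi)\colon(P(X,\alpha),\pi)\to(P(Y,\beta),\pi)$ sends $(p,g)$ to the presheaf of type $p$ given by $y\mapsto\bigvee_{x\in X_0}\beta(y,\varphi(x))\circ g(x)$. A functor $\varphi$ between separated cocomplete $\mathcal{Q}$-categories is cocontinuous if $\varphi\circ\sup_X=\sup_Y\circ\,\mathbb{P}(\varphi)$. $\mathtt{Cat}_{sc}(\mathcal{Q})$ is the category of separated and cocomplete $\mathcal{Q}$-categories with cocontinuous functors. **Particular objects.** $(\mathcal{Q},\tau)$ is the $\mathcal{Q}$-category with underlying set $\mathcal{Q}_0$, type map the identity, and $\tau(p,q)=\bigvee\hom(q,p)$; it is the terminal object of $\mathtt{Cat}_{sc}(\mathcal{Q})$,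 the unique morphism $(Y,\beta)\to(\mathcal{Q},\tau)$ being the type map. A morphism $u$ with domain $r$ is right-sided if $u\circ\tau(r,r)\le u$. $(\mathbb{R}(\mathcal{R}^{r}),\varrho)$ is the separated cocomplete $\mathcal{Q}$-category whose underlying set $\mathbb{R}(\mathcal{R}_0^{r})$ consists of all right-sided morphisms with domain $r$, with type map $|u|=\mathrm{codom}(u)$ and $\varrho(u,v)=u\swarrow v$; here $\sup(p,g)=\bigwedge_{u}(g(u)\searrow u)$, the meet over all $u\in\mathbb{R}(\mathcal{R}_0^{r})$. The cocontinuous functor $\mathrm{true}_r\colon(\mathcal{Q},\tau)\to(\mathbb{R}(\mathcal{R}^{r}),\varrho)$ is $q\mapsto\tau(q,r)$. *)

(* Defs.v *)
From HB Require Import structures.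
From mathcomp Require Import all_boot all_order.
From mathcomp Require Import boolp classical_sets.

Set Implicit Arguments.
Unset Strict Implicit.
Unset Printing Implicit Defensive.

Import Order.TTheory.

Local Open Scope classical_set_scope.
Local Open Scope order_scope.

(* [qcomp v u] is v after u. Only joins are given as structure: the meets of
   the complete lattices hom p q are derived from them in [qinf]. *)
Record quantaloid (d : Order.disp_t) := Quantaloid {
  qob :> Type;
  hom : qob -> qob -> porderType d;
  qid : forall p, hom p p;
  qcomp : forall p q r, hom q r -> hom p q -> hom p r;
  compA : forall p q r s (w : hom r s) (v : hom q r) (u : hom p q),
    qcomp w (qcomp v u) = qcomp (qcomp w v) u;
  comp1l : forall p q (u : hom p q), qcomp (qid q) u = u;
  comp1r : forall p q (u : hom p q), qcomp u (qid p) = u;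
  qsup : forall p q, set (hom p q) -> hom p q;
  qsupP : forall p q (A : set (hom p q)), supremums A (qsup A);
  comp_supr : forall p q r (v : hom q r) (A : set (hom p q)),
    qcomp v (qsup A) = qsup [set qcomp v u | u in A];
  comp_supl : forall p q r (A : set (hom q r)) (u : hom p q),
    qcomp (qsup A) u = qsup [set qcomp v u | v in A]
}.

Arguments hom {d Q} p q : rename.
Arguments qid {d Q} p : rename.
Arguments qcomp {d Q p q r} v u : rename.
Arguments qsup {d Q p q} A : rename.

Definition qinf d (Q : quantaloid d) (p q : Q) (A : set (hom p q)) : hom p q :=
  qsup (lbound A).

Definition swarrow d (Q : quantaloid d) (p q r : Q)
  (u : hom p q) (v : hom p r) : hom r q := qsup [set h | qcomp h v <= u].

Definition searrow d (Q : quantaloid d) (p q r : Q)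
  (v : hom r q) (u : hom p q) : hom p r := qsup [set h | qcomp v h <= u].

(* Type-preserving maps preserve types only up to a propositional equality of
   objects, along which the morphisms have to be transported. *)
Definition cast d (Q : quantaloid d) (p q p' q' : Q)
    (ep : p = p') (eq : q = q') (u : hom p q) : hom p' q' :=
  let: erefl := ep in let: erefl := eq in u.

Section QuantaloidFacts.
Context {d : Order.disp_t} {Q : quantaloid d}.
Implicit Types p q r s : Q.

Lemma qsup_ub p q (A : set (hom p q)) u : A u -> u <= qsup A.
Proof. by move=> Au; have [ubA _] := qsupP A; apply: ubA. Qed.

Lemma qsup_le p q (A : set (hom p q)) w :
  (forall u, A u -> u <= w) -> qsup A <= w.
Proof. by move=> Aw; have [_ lbA] := qsupP A; apply: lbA. Qed.

Lemma qinf_lb p q (A : set (hom p q)) u : A u -> qinf A <= u.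
Proof. by move=> Au; apply: qsup_le => w; apply. Qed.

Lemma qinf_ge p q (A : set (hom p q)) w :
  (forall u, A u -> w <= u) -> w <= qinf A.
Proof. by move=> Aw; apply: qsup_ub => u; apply: Aw. Qed.

Lemma comp_ler p q r (v : hom q r) (u u' : hom p q) :
  u <= u' -> qcomp v u <= qcomp v u'.
Proof.
move=> uu'; have -> : u' = qsup [set u; u'].
  apply/le_anti/andP; split; first by apply: qsup_ub; right.
  by apply: qsup_le => w [] ->.
by rewrite comp_supr; apply: qsup_ub; exists u => //; left.
Qed.

Lemma comp_lel p q r (v v' : hom q r) (u : hom p q) :
  v <= v' -> qcomp v u <= qcomp v' u.
Proof.
move=> vv'; have -> : v' = qsup [set v; v'].
  apply/le_anti/andP; split; first by apply: qsup_ub; right.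
  by apply: qsup_le => w [] ->.
by rewrite comp_supl; apply: qsup_ub; exists v => //; left.
Qed.

Lemma le_swarrow p q r (u : hom p q) (v : hom p r) (h : hom r q) :
  h <= swarrow u v <-> qcomp h v <= u.
Proof.
split=> [hs|]; last by move=> ?; apply: qsup_ub.
apply: (le_trans (comp_lel v hs)); rewrite comp_supl.
by apply: qsup_le => _ [k ku <-].
Qed.

Lemma le_searrow p q r (v : hom r q) (u : hom p q) (h : hom p r) :
  h <= searrow v u <-> qcomp v h <= u.
Proof.
split=> [hs|]; last by move=> ?; apply: qsup_ub.
apply: (le_trans (comp_ler v hs)); rewrite comp_supr.
by apply: qsup_le => _ [k ku <-].
Qed.

Lemma comp_castl p q q' r r' (e : q = q') (e' : r = r') (v : hom q r)
    (u : hom p q') :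
  qcomp (cast e e' v) u = cast erefl e' (qcomp v (cast erefl (esym e) u)).
Proof. by case: _ / e u; case: _ / e'. Qed.

Lemma cast_le p q p' q' (e : p = p') (e' : q = q') (u v : hom p q) :
  (cast e e' u <= cast e e' v) = (u <= v).
Proof. by case: _ / e; case: _ / e'. Qed.

End QuantaloidFacts.

Record qcat d (Q : quantaloid d) := QCat {
  qel :> Type;
  ty : qel -> Q;
  al : forall x y, hom (ty y) (ty x);
  al_comp : forall x y z, qcomp (al x y) (al y z) <= al x z;
  al_id : forall x, qid (ty x) <= al x x
}.

Record qfunctor d (Q : quantaloid d) (X Y : qcat Q) := QFunctor {
  qmap :> X -> Y;
  fty : forall x, ty (qmap x) = ty x;
  fle : forall x1 x2,
    al x1 x2 <= cast (fty x2) (fty x1) (al (qmap x1) (qmap x2))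
}.

Definition separated d (Q : quantaloid d) (X : qcat Q) : Prop :=
  forall (x y : X) (e : ty x = ty y),
    cast e erefl (al x x) = al x y ->
    cast (esym e) erefl (al y y) = al y x -> x = y.

Record presheaf d (Q : quantaloid d) (X : qcat Q) := Presheaf {
  pty : Q;
  pval : forall x : X, hom pty (ty x);
  pval_le : forall x1 x2, qcomp (al x1 x2) (pval x2) <= pval x1
}.

Definition ppi d (Q : quantaloid d) (X : qcat Q) (F G : presheaf X) :
    hom (pty G) (pty F) :=
  qinf (range (fun x : X => searrow (pval F x) (pval G x))).

Lemma le_ppi d (Q : quantaloid d) (X : qcat Q) (F G : presheaf X) h :
  h <= ppi F G <-> forall x, qcomp (pval F x) h <= pval G x.
Proof.
split=> [hF x|hF].
  by apply/le_searrow; apply: (le_trans hF); apply: qinf_lb; exists x.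
by apply: qinf_ge => _ [x _ <-]; apply/le_searrow.
Qed.

Lemma ppi_comp d (Q : quantaloid d) (X : qcat Q) (F G H : presheaf X) :
  qcomp (ppi F G) (ppi G H) <= ppi F H.
Proof.
apply: (iffRL (le_ppi _)) => x; rewrite compA.
have /le_ppi/(_ x) h1 := lexx (ppi F G).
have /le_ppi/(_ x) h2 := lexx (ppi G H).
by apply: le_trans h2; apply: comp_lel.
Qed.

Lemma ppi_id d (Q : quantaloid d) (X : qcat Q) (F : presheaf X) :
  qid (pty F) <= ppi F F.
Proof. by apply: (iffRL (le_ppi _)) => x; rewrite comp1r. Qed.

Definition psh d (Q : quantaloid d) (X : qcat Q) : qcat Q :=
  QCat (@ppi_comp d Q X) (@ppi_id d Q X).

Lemma le_psh d (Q : quantaloid d) (X : qcat Q) (F G : psh X)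
    (h : hom (pty G) (pty F)) :
  h <= @al d Q (psh X) F G <-> forall x, qcomp (pval F x) h <= pval G x.
Proof. exact: le_ppi. Qed.

Definition yoneda_psh d (Q : quantaloid d) (X : qcat Q) (x : X) : psh X :=
  Presheaf (fun x1 x2 => al_comp x1 x2 x).

Lemma yoneda_le d (Q : quantaloid d) (X : qcat Q) (x1 x2 : X) :
  al x1 x2 <= al (yoneda_psh x1) (yoneda_psh x2).
Proof.
apply (iffRL (@le_psh d Q X (yoneda_psh x1) (yoneda_psh x2) _)) => x.
exact: al_comp.
Qed.

Definition yoneda d (Q : quantaloid d) (X : qcat Q) : qfunctor X (psh X) :=
  @QFunctor d Q X (psh X) (@yoneda_psh d Q X) (fun=> erefl)
    (@yoneda_le d Q X).

Definition Pval d (Q : quantaloid d) (X Y : qcat Q) (f : qfunctor X Y)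
    (F : presheaf X) (y : Y) : hom (pty F) (ty y) :=
  qsup (range (fun x : X =>
    qcomp (al y (f x)) (cast erefl (esym (fty f x)) (pval F x)))).

Lemma Pval_le d (Q : quantaloid d) (X Y : qcat Q) (f : qfunctor X Y)
    (F : presheaf X) (y1 y2 : Y) :
  qcomp (al y1 y2) (Pval f F y2) <= Pval f F y1.
Proof.
rewrite comp_supr; apply: qsup_le => _ [_ [x _ <-] <-].
rewrite compA; apply: (le_trans (comp_lel _ (al_comp _ _ _))).
by apply: qsup_ub; exists x.
Qed.

Definition Pmap_psh d (Q : quantaloid d) (X Y : qcat Q) (f : qfunctor X Y)
  (F : psh X) : psh Y := Presheaf (@Pval_le d Q X Y f F).

Lemma Pmap_le d (Q : quantaloid d) (X Y : qcat Q) (f : qfunctor X Y)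
    (F G : psh X) : al F G <= al (Pmap_psh f F) (Pmap_psh f G).
Proof.
apply (iffRL (@le_psh d Q Y (Pmap_psh f F) (Pmap_psh f G) _)) => y /=.
rewrite comp_supl; apply: qsup_le => _ [_ [x _ <-] <-].
have /le_ppi/(_ x) h := lexx (ppi F G).
have: qcomp (cast erefl (esym (fty f x)) (pval F x)) (ppi F G)
    <= cast erefl (esym (fty f x)) (pval G x).
  by rewrite comp_castl cast_le.
rewrite -compA => /(comp_ler (al y (f x)))/le_trans; apply.
by apply: qsup_ub; exists x.
Qed.

Definition Pmap d (Q : quantaloid d) (X Y : qcat Q) (f : qfunctor X Y) :
    qfunctor (psh X) (psh Y) :=
  @QFunctor d Q (psh X) (psh Y) (Pmap_psh f) (fun=> erefl)
    (@Pmap_le d Q X Y f).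

Definition yoneda_left_adjoint d (Q : quantaloid d) (X : qcat Q)
    (s : qfunctor (psh X) X) : Prop :=
  forall (F : psh X) (x : X),
    cast erefl (fty s F) (al (s F) x) = al F (yoneda X x).

(* Separatedness determines the left adjoint [sc_sup] uniquely. *)
Record catsc d (Q : quantaloid d) := CatSC {
  sc_cat :> qcat Q;
  sc_sep : separated sc_cat;
  sc_sup : qfunctor (psh sc_cat) sc_cat;
  sc_adj : yoneda_left_adjoint sc_sup
}.

Record cocont d (Q : quantaloid d) (X Y : catsc Q) := Cocont {
  cfun :> qfunctor X Y;
  cfun_sup : forall F : psh X, cfun (sc_sup X F) = sc_sup Y (Pmap cfun F)
}.

(* The square f \o p1 = g \o p2 is a pullback in the category [catsc Q] of
   separated cocomplete categories and cocontinuous functors. *)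
Definition is_pullback d (Q : quantaloid d) (P A B C : catsc Q)
    (p1 : cocont P A) (p2 : cocont P B) (f : cocont A C) (g : cocont B C) :
    Prop :=
  f \o p1 =1 g \o p2 /\
  forall (Z : catsc Q) (z1 : cocont Z A) (z2 : cocont Z B),
    f \o z1 =1 g \o z2 ->
    exists h : cocont Z P,
      (p1 \o h =1 z1 /\ p2 \o h =1 z2) /\
      forall h' : cocont Z P, p1 \o h' =1 z1 -> p2 \o h' =1 z2 -> h' =1 h.

Definition tau d (Q : quantaloid d) (p q : Q) : hom q p := qsup setT.

Lemma le_tau d (Q : quantaloid d) (p q : Q) (u : hom q p) : u <= tau p q.
Proof. exact: qsup_ub. Qed.

Lemma ge_tau d (Q : quantaloid d) (p q : Q) (u : hom q p) :
  tau p q <= u -> u = tau p q.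
Proof. by move=> h; apply/le_anti; rewrite h le_tau. Qed.

Definition Qcat d (Q : quantaloid d) : qcat Q :=
  @QCat d Q Q id (@tau d Q) (fun _ _ _ => le_tau _) (fun=> le_tau _).

Lemma Qcat_sep d (Q : quantaloid d) : separated (Qcat Q).
Proof. by move=> x y e. Qed.

Definition Qsup d (Q : quantaloid d) : qfunctor (psh (Qcat Q)) (Qcat Q) :=
  @QFunctor d Q (psh (Qcat Q)) (Qcat Q) (@pty d Q (Qcat Q)) (fun=> erefl)
    (fun _ _ => le_tau _).

Lemma Qsup_adj d (Q : quantaloid d) : yoneda_left_adjoint (Qsup Q).
Proof.
move=> F x; apply/esym/ge_tau.
apply (iffRL (@le_psh d Q (Qcat Q) F (yoneda (Qcat Q) x) _)) => y.
exact: le_tau.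
Qed.

Definition Qsc d (Q : quantaloid d) : catsc Q :=
  CatSC (@Qcat_sep d Q) (@Qsup_adj d Q).

Lemma type_le d (Q : quantaloid d) (Y : qcat Q) (y1 y2 : Y) :
  al y1 y2 <= @al d Q (Qcat Q) (ty y1) (ty y2).
Proof. exact: le_tau. Qed.

Definition type_functor d (Q : quantaloid d) (Y : qcat Q) :
    qfunctor Y (Qcat Q) :=
  @QFunctor d Q Y (Qcat Q) (@ty d Q Y) (fun=> erefl) (@type_le d Q Y).

Lemma type_sup d (Q : quantaloid d) (Y : catsc Q) (F : psh Y) :
  type_functor Y (sc_sup Y F) = sc_sup (Qsc Q) (Pmap (type_functor Y) F).
Proof. exact: (fty (sc_sup Y) F). Qed.

Definition type_map d (Q : quantaloid d) (Y : catsc Q) : cocont Y (Qsc Q) :=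
  @Cocont d Q Y (Qsc Q) (type_functor Y) (@type_sup d Q Y).

Definition right_sided d (Q : quantaloid d) (r q : Q) (u : hom r q) : Prop :=
  qcomp u (tau r r) <= u.

Record rsided d (Q : quantaloid d) (r : Q) := RSided {
  rs_cod : Q;
  rs_mor : hom r rs_cod;
  rs_right : right_sided rs_mor
}.

Lemma rsided_eq d (Q : quantaloid d) (r q : Q) (u v : hom r q)
    (hu : right_sided u) (hv : right_sided v) :
  u = v -> RSided hu = RSided hv.
Proof. by move=> uv; case: _ / uv hv => hv; congr RSided; apply: Prop_irrelevance. Qed.

Definition rho d (Q : quantaloid d) (r : Q) (u v : rsided r) :
  hom (rs_cod v) (rs_cod u) := swarrow (rs_mor u) (rs_mor v).

Lemma rho_comp d (Q : quantaloid d) (r : Q) (u v w : rsided r) :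
  qcomp (rho u v) (rho v w) <= rho u w.
Proof.
apply: (iffRL (le_swarrow _ _ _)); rewrite -compA.
have /le_swarrow h1 := lexx (rho u v); have /le_swarrow h2 := lexx (rho v w).
exact: le_trans (comp_ler _ h2) h1.
Qed.

Lemma rho_id d (Q : quantaloid d) (r : Q) (u : rsided r) :
  qid (rs_cod u) <= rho u u.
Proof. by apply: (iffRL (le_swarrow _ _ _)); rewrite comp1l. Qed.

Definition Rcat d (Q : quantaloid d) (r : Q) : qcat Q :=
  QCat (@rho_comp d Q r) (@rho_id d Q r).

Lemma le_Rcat d (Q : quantaloid d) (r : Q) (u v : Rcat r)
    (h : hom (rs_cod v) (rs_cod u)) :
  h <= @al d Q (Rcat r) u v <-> qcomp h (rs_mor v) <= rs_mor u.
Proof. exact: le_swarrow. Qed.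

Lemma Rcat_sep d (Q : quantaloid d) (r : Q) : separated (Rcat r).
Proof.
move=> [p u hu] [q v hv] /= e; case: _ / e v hv => v hv /= e1 e2.
apply: rsided_eq; apply/le_anti/andP; split.
  have := rho_id (RSided hv); rewrite -[rho _ _]/(rho _ _) e2.
  by move/le_swarrow; rewrite comp1l.
have := rho_id (RSided hu); rewrite e1.
by move/le_swarrow; rewrite comp1l.
Qed.

Definition Rsup_mor d (Q : quantaloid d) (r : Q) (F : psh (Rcat r)) :
    hom r (pty F) :=
  qinf (range (fun u : Rcat r => searrow (pval F u) (rs_mor u))).

Lemma le_Rsup d (Q : quantaloid d) (r : Q) (F : psh (Rcat r)) h :
  h <= Rsup_mor F <-> forall u : Rcat r, qcomp (pval F u) h <= rs_mor u.
Proof.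
split=> [hF x|hF].
  by apply/le_searrow; apply: (le_trans hF); apply: qinf_lb; exists x.
by apply: qinf_ge => _ [x _ <-]; apply/le_searrow.
Qed.

Lemma Rsup_right d (Q : quantaloid d) (r : Q) (F : psh (Rcat r)) :
  right_sided (Rsup_mor F).
Proof.
apply/le_Rsup => u; rewrite compA.
have /le_Rsup/(_ u) h := lexx (Rsup_mor F).
exact: le_trans (comp_lel _ h) (rs_right u).
Qed.

Definition Rsup_el d (Q : quantaloid d) (r : Q) (F : psh (Rcat r)) : Rcat r :=
  RSided (@Rsup_right d Q r F).

Lemma Rsup_le d (Q : quantaloid d) (r : Q) (F G : psh (Rcat r)) :
  al F G <= al (Rsup_el F) (Rsup_el G).
Proof.
apply (iffRL (@le_Rcat d Q r (Rsup_el F) (Rsup_el G) _)); apply/le_Rsup => u /=; rewrite compA.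
have /le_ppi/(_ u) h1 := lexx (ppi F G).
have /le_Rsup/(_ u) h2 := lexx (Rsup_mor G).
exact: le_trans (comp_lel _ h1) h2.
Qed.

Definition Rsup d (Q : quantaloid d) (r : Q) :
    qfunctor (psh (Rcat r)) (Rcat r) :=
  @QFunctor d Q (psh (Rcat r)) (Rcat r) (@Rsup_el d Q r) (fun=> erefl)
    (@Rsup_le d Q r).

Lemma Rsup_adj d (Q : quantaloid d) (r : Q) : yoneda_left_adjoint (Rsup r).
Proof.
move=> F v; apply/le_anti/andP; split.
  apply (iffRL (@le_psh d Q (Rcat r) F (yoneda (Rcat r) v) _)) => u /=; apply (iffRL (@le_Rcat d Q r u v _)); rewrite -compA.
  have /le_swarrow/le_Rsup := lexx (rho (Rsup_el F) v); exact.
apply (iffRL (@le_Rcat d Q r (Rsup_el F) v _)); apply/le_Rsup => u; rewrite compA; apply/le_swarrow.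
by have /le_ppi := lexx (ppi F (yoneda_psh v)); apply.
Qed.

Definition Rsc d (Q : quantaloid d) (r : Q) : catsc Q :=
  CatSC (@Rcat_sep d Q r) (@Rsup_adj d Q r).

Lemma tau_right d (Q : quantaloid d) (r q : Q) : right_sided (tau q r).
Proof. exact: le_tau. Qed.

Definition true_el d (Q : quantaloid d) (r : Q) (q : Qcat Q) : Rcat r :=
  RSided (@tau_right d Q r q).

Lemma true_le d (Q : quantaloid d) (r : Q) (p q : Qcat Q) :
  al p q <= al (true_el r p) (true_el r q).
Proof. apply (iffRL (@le_Rcat d Q r (true_el r p) (true_el r q) _)); exact: le_tau. Qed.

Definition true_functor d (Q : quantaloid d) (r : Q) :
    qfunctor (Qcat Q) (Rcat r) :=
  @QFunctor d Q (Qcat Q) (Rcat r) (true_el r) (fun=> erefl) (@true_le d Q r).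

Lemma true_sup d (Q : quantaloid d) (r : Q) (F : psh (Qsc Q)) :
  true_functor r (sc_sup (Qsc Q) F) = sc_sup (Rsc r) (Pmap (true_functor r) F).
Proof.
apply: rsided_eq; apply/esym/ge_tau.
apply (iffRL (@le_Rsup d Q r (Pmap (true_functor r) F) _)) => u /=.
rewrite comp_supl; apply: qsup_le => _ [_ [q _ <-] <-] /=.
rewrite -compA; apply: (le_trans (comp_ler _ (le_tau _))).
by have /le_swarrow := lexx (rho u (true_el r q)).
Qed.

Definition true_map d (Q : quantaloid d) (r : Q) : cocont (Qsc Q) (Rsc r) :=
  @Cocont d Q (Qsc Q) (Rsc r) (true_functor r) (@true_sup d Q r).

(* Main.v *)
Require Import Defs.
From mathcomp Require Import all_boot all_order.
From mathcomp Require Import boolp classical_sets.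

(** Spelling out the hom of R(R^r), a functor chi into it satisfies
    alpha(x1, x2) o chi(x2) <= chi(x1): chi is a presheaf of type r on X, with
    right-sided values. Cocontinuity turns the supremum of a presheaf F into
    the meet of the F(x) \searrow chi(x) ([le_chi_sup]).

    The right-hand side of the formula is below chi(x) because
    chi(phi(y)) = tau(|y|, r). Conversely, put u := chi(x) and let s be the
    tensor of x by u, that is the supremum of the presheaf alpha(_, x) o u of
    type r. Then chi(s) = u \searrow u, which is tau(r, r) because u is
    right-sided ([top_tensor]), and u <= alpha(x, s) ([sup_unit]). If
    s = phi(y), the summand at y is therefore above u.

    That s is in the image of phi comes from the universal property of the
    pullback, tested on one object: the elements x of X with
    chi(x) = tau(|x|, r) are closed under suprema ([top_closed]), so they form
    a full subcategory which is itself separated and cocomplete with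
    cocontinuous inclusion ([subsc], [incl]). This inclusion therefore factors
    through phi ([pullback_top]). *)

Set Implicit Arguments.
Unset Strict Implicit.
Unset Printing Implicit Defensive.

Import Order.TTheory.

Local Open Scope classical_set_scope.
Local Open Scope order_scope.

(** * Transport along equalities of objects *)

Section Transport.
Context {d : Order.disp_t} {Q : quantaloid d}.
Implicit Types p q r : Q.

Lemma cast_tau p q q' (e : q = q') :
  cast erefl e (tau q p) = tau q' p.
Proof. by case: _ / e. Qed.

Lemma cast_right_sided r q q' (e : q = q') (u : hom r q) :
  right_sided u -> right_sided (cast erefl e u).
Proof. by case: _ / e. Qed.

Lemma comp_cast_le p p' q q' r (ep : p = p') (eq : q = q')
    (g : hom p q) (v : hom r p') (u : hom r q') :
  qcomp (cast ep eq g) v <= u <->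
  qcomp g (cast erefl (esym ep) v) <= cast erefl (esym eq) u.
Proof. by case: _ / ep v; case: _ / eq u. Qed.

Lemma castK q q' r (e : q = q') (e' : q' = q) (u : hom r q) :
  cast erefl e' (cast erefl e u) = u.
Proof. by case: _ / e e' => e'; rewrite (Prop_irrelevance e' erefl). Qed.

Lemma le_comp_tau p q r (e : p = r) (v : hom p q) (u : hom r q) :
  u <= cast e erefl v -> u <= qcomp v (tau p r).
Proof.
case: _ / e u => u /= uv; apply: (le_trans uv).
by rewrite -[leLHS]comp1r; apply/comp_ler/le_tau.
Qed.

Lemma comp_cast_id p q r (e : p = r) (v : hom p q) (u : hom r q) :
  qcomp u (cast erefl e (qid p)) <= v -> u <= cast e erefl v.
Proof. by case: _ / e u => u; rewrite comp1r. Qed.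

End Transport.

(** The unit of the adjunction between suprema and the Yoneda embedding. *)
Lemma sup_unit d (Q : quantaloid d) (X : catsc Q) (F : psh X) (x : X) :
  pval F x <= cast (fty (sc_sup X) F) erefl (al x (sc_sup X F)).
Proof.
apply: comp_cast_id.
apply: (iffLR (@le_psh d Q X F (yoneda X (sc_sup X F)) _)).
by rewrite -sc_adj cast_le al_id.
Qed.

(** * Full subcategories closed under suprema *)

Section FullSubcategory.
Context {d : Order.disp_t} {Q : quantaloid d} (X : catsc Q) (S : set X).

Definition subcat : qcat Q :=
  @QCat d Q {x : X | S x} (fun z => ty (sval z))
    (fun z w => al (sval z) (sval w))
    (fun x y z => al_comp (sval x) (sval y) (sval z))
    (fun x => al_id (sval x)).

Definition subincl : qfunctor subcat X :=
  @QFunctor d Q subcat X sval (fun=> erefl) (fun _ _ => lexx _).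

Lemma subcat_sep : separated subcat.
Proof.
move=> [x Sx] [y Sy] e exy eyx; apply: eq_exist.
exact: (@sc_sep d Q X x y e exy eyx).
Qed.

(** Extending a presheaf from the subcategory to [X] does not change the
    morphisms from it to the presheaves represented in the subcategory; hence
    suprema may be computed in [X]. *)
Lemma al_incl_yoneda (F : psh subcat) (z : subcat) :
  al (Pmap subincl F) (yoneda X (sval z)) = al F (yoneda subcat z).
Proof.
apply/le_anti/andP; split.
  apply (iffRL (@le_psh d Q subcat F (yoneda subcat z) _)) => w.
  have := iffLR (@le_psh d Q X (Pmap subincl F) (yoneda X (sval z)) _)
    (lexx _) (sval w).
  apply: le_trans; apply: comp_lel => /=.
  apply: (@le_trans _ _ (qcomp (al (sval w) (sval w)) (pval F w))).
    by rewrite -[leLHS]comp1l; apply/comp_lel/al_id.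
  by apply: qsup_ub; exists w.
apply (iffRL (@le_psh d Q X (Pmap subincl F) (yoneda X (sval z)) _)) => x /=.
rewrite comp_supl; apply: qsup_le => _ [_ [w _ <-] <-] /=; rewrite -Defs.compA.
apply: le_trans (al_comp x (sval w) (sval z)); apply: comp_ler.
exact: (iffLR (@le_psh d Q subcat F (yoneda subcat z) _) (lexx _) w).
Qed.

Hypothesis S_sup : forall F : psh subcat, S (sc_sup X (Pmap subincl F)).

Definition subsup_el (F : psh subcat) : subcat := exist _ _ (S_sup F).

Lemma subsup_le (F G : psh subcat) :
  al F G <= cast (fty (sc_sup X) (Pmap subincl G))
                 (fty (sc_sup X) (Pmap subincl F))
                 (al (subsup_el F) (subsup_el G)).
Proof.
exact: le_trans (Pmap_le subincl F G)
  (fle (sc_sup X) (Pmap subincl F) (Pmap subincl G)).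
Qed.

Definition subsup : qfunctor (psh subcat) subcat :=
  @QFunctor d Q (psh subcat) subcat subsup_el
    (fun F => fty (sc_sup X) (Pmap subincl F)) subsup_le.

Lemma subsup_adj : yoneda_left_adjoint subsup.
Proof.
by move=> F z; rewrite -al_incl_yoneda -(sc_adj (Pmap subincl F) (sval z)).
Qed.

Definition subsc : catsc Q := CatSC subcat_sep subsup_adj.

Definition incl : cocont subsc X :=
  @Cocont d Q subsc X subincl (fun=> erefl).

End FullSubcategory.

(** * Cocontinuous functors into right-sided morphisms, as presheaves *)

Section RightSided.
Context {d : Order.disp_t} {Q : quantaloid d} (r : Q) (X : catsc Q).
Variable chi : cocont X (Rsc r).
Implicit Types x : X.

Definition chi_val x : hom r (ty x) :=
  cast erefl (fty chi x) (rs_mor (chi x)).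

Lemma chi_val_right x : right_sided (chi_val x).
Proof. exact/cast_right_sided/rs_right. Qed.

Lemma chi_val_le x1 x2 : qcomp (al x1 x2) (chi_val x2) <= chi_val x1.
Proof.
have := fle chi x1 x2; rewrite /chi_val.
move/(comp_lel (cast erefl (fty chi x2) (rs_mor (chi x2))))/le_trans; apply.
apply/comp_cast_le; rewrite !castK.
exact: (iffLR (@le_Rcat d Q r (chi x1) (chi x2) _) (lexx _)).
Qed.

(** The meet defining a supremum in R(R^r) ranges over all right-sided
    morphisms, but for the image of [F] under [chi] the values of [chi]
    suffice: that image is generated by the elements [chi x] with weights
    [pval F x]. *)
Lemma le_chi_sup (F : psh X) (h : hom r (pty F)) :
  (forall x, qcomp (pval F x) h <= chi_val x) ->
  h <= cast erefl (fty (sc_sup X) F) (chi_val (sc_sup X F)).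
Proof.
move=> Fh; rewrite /chi_val.
(* Cocontinuity is an equality of elements, hence changes the type along
   which the value is transported; the equalities of types are generalized so
   that they follow it. *)
move: (fty chi (sc_sup X F)) (fty (sc_sup X) F).
rewrite cfun_sup => e1 e2; rewrite castK.
apply: (iffRL (@le_Rsup d Q r (Pmap chi F) h)) => u /=.
rewrite comp_supl; apply: qsup_le => _ [_ [x _ <-] <-] /=; rewrite -Defs.compA.
apply: (@le_trans _ _ (qcomp (rho u (chi x)) (rs_mor (chi x)))); last first.
  by apply/le_swarrow.
apply: comp_ler.
apply (iffRL (comp_cast_le erefl (esym (fty chi x)) (pval F x) h _)).
by rewrite esymK; apply: Fh.
Qed.

Definition top_set : set X := [set x | chi_val x = tau (ty x) r].

Lemma top_setP x : top_set x -> chi x = true_map r (type_map X x).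
Proof.
rewrite /top_set /= /chi_val; move: (fty chi x).
case: (chi x : rsided r) => q u hu /= e.
by case: _ / e => uE; apply: rsided_eq.
Qed.

Lemma top_sup (F : psh X) :
  (forall x, qcomp (pval F x) (tau (pty F) r) <= chi_val x) ->
  top_set (sc_sup X F).
Proof.
move=> /le_chi_sup; rewrite -(cast_tau r (fty (sc_sup X) F)) cast_le.
exact: ge_tau.
Qed.

Lemma top_closed (F : psh (subcat top_set)) :
  top_set (sc_sup X (Pmap (subincl top_set) F)).
Proof.
apply: top_sup => x /=.
rewrite comp_supl; apply: qsup_le => _ [_ [[z ztop] _ <-] <-] /=.
rewrite -Defs.compA; apply: le_trans (chi_val_le x z); apply: comp_ler.
by rewrite ztop; apply: le_tau.
Qed.

Lemma tensor_le x x1 x2 :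
  qcomp (al x1 x2) (qcomp (al x2 x) (chi_val x)) <=
  qcomp (al x1 x) (chi_val x).
Proof. by rewrite Defs.compA; apply/comp_lel/al_comp. Qed.

(** The presheaf whose supremum is the tensor of [x] by [chi_val x]. *)
Definition tensor_psh x : psh X := Presheaf (@tensor_le x).

Lemma top_tensor x : top_set (sc_sup X (tensor_psh x)).
Proof.
apply: top_sup => x' /=; rewrite -Defs.compA.
exact: le_trans (comp_ler _ (chi_val_right x)) (chi_val_le x' x).
Qed.

Lemma chi_val_le_tensor x (s := sc_sup X (tensor_psh x)) :
  chi_val x <= qcomp (al x s) (tau (ty s) r).
Proof.
apply: (le_comp_tau (e := fty (sc_sup X) (tensor_psh x))).
apply: le_trans (sup_unit (tensor_psh x) x) => /=.
by rewrite -[leLHS]comp1l; apply/comp_lel/al_id.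
Qed.

Lemma chi_val_true x q : chi x = true_map r q -> chi_val x = tau (ty x) r.
Proof.
by rewrite /chi_val; move: (fty chi x) => /[swap] -> e; apply: cast_tau.
Qed.

End RightSided.

(** * Pullbacks of the truth functor *)

Lemma pullback_top d (Q : quantaloid d) (r : Q) (X Y : catsc Q)
    (phi : cocont Y X) (chi : cocont X (Rsc r)) :
  is_pullback phi (type_map Y) chi (true_map r) ->
  forall s : X, top_set chi s -> exists y : Y, phi y = s.
Proof.
move=> [_ univ] s stop; pose Z := subsc (@top_closed _ _ _ _ chi).
have [|h [[phih _] _]] := univ Z (incl (@top_closed _ _ _ _ chi)) (type_map Z).
  by move=> [z ztop]; apply: top_setP.
by exists (h (exist _ s stop)); apply: phih.
Qed.

Theorem theorem4p10 (d : Order.disp_t) (Q : quantaloid d) (r : Q)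
    (X Y : catsc Q) (phi : cocont Y X) (chi : cocont X (Rsc r)) :
  is_pullback phi (type_map Y) chi (true_map r) ->
  forall x : X,
    cast erefl (fty chi x) (rs_mor (chi x)) =
    qsup (range (fun y : Y =>
      qcomp (al x (phi y)) (cast erefl (esym (fty phi y)) (tau (ty y) r)))).
Proof.
move=> pb x; rewrite -/(chi_val chi x); apply/le_anti/andP; split.
  have [y phiy] := pullback_top pb (top_tensor chi x).
  apply: (le_trans (chi_val_le_tensor chi x)); rewrite -phiy.
  by apply: qsup_ub; exists y => //; rewrite cast_tau.
apply: qsup_le => _ [y _ <-]; rewrite cast_tau.
have [/(_ y) comm _] := pb.
by rewrite -(chi_val_true comm); apply: chi_val_le.
Qed.
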